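(* For every $\epsilon>0$ there exists $\delta>0$ such that if $\Delta=\Delta(n)$ is an integer with $n^{\epsilon}\le \Delta\le \frac{n}{\ln n}$, then the random graph $G(n,p)$ with $p=\frac{\delta\Delta\ln n}{n}$ with high probability does not contain a copy of the tree $T(n,\Delta)$ (i.e. a subgraph isomorphic to $T(n,\Delta)$). Explicitly: for every $\epsilon>0$ there exists $\delta>0$ such that for every $\eta>0$ there is $n_0$ such that for all $n\ge n_0$ and all integers $\Delta$ with $n^{\epsilon}\le\Delta\le n/\ln n$, the probability that $G(n,\delta\Delta\ln n/n)$ contains a copy of $T(n,\Delta)$ is at most $\eta$.
   Context: $G(n,p)$ is the binomial random graph on vertex set $[n]=\{1,\ldots,n\}$, in which each of the $\binom n2$ pairs is an edge independently with probability $p$. An event holds with high probability if its probability tends to $1$ as $n\to\infty$. $\ln$ is the natural logarithm. Definition of $T(n,\Delta)$ for integers $n\ge\Delta\ge 3$: write $n=(\Delta-1)k-r$ with integers $k$ and $0\le r\le \Delta-2$ (so $k=\lceil n/(\Delta-1)\rceil$). Take a path $P=(v_1,\ldots,v_k)$ with $k$ vertices; attach to each of $v_1,\ldots,v_{k-1}$ exactly $\Delta-2$ new leaves, and attach to $v_k$ exactly $\Delta-2-r$ new leaves (all the attached leaves being distinct). The resulting tree $T(n,\Delta)$ has $n$ vertices and maximum degree at most $\Delta$. *)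

(* Defs.v *)
From HB Require Import structures.
From mathcomp Require Import all_boot all_order all_algebra.
From mathcomp Require Import all_classical all_reals all_analysis.
From mathcomp Require Import zify.

Set Implicit Arguments.
Unset Strict Implicit.
Unset Printing Implicit Defensive.

Import Order.TTheory GRing.Theory Num.Theory.

Local Open Scope ring_scope.

(* A simple graph on the vertex set 'I_n is given by its edge set
   E : {set {set 'I_n}}, with E \subset vpairs n. *)
Definition vpairs (n : nat) : {set {set 'I_n}} :=
  [set e : {set 'I_n} | #|e| == 2%N].

(* The point mass of G(n,p): the pairs are independent, each one is an edge with
   probability p.  Both gnp_mass and gnp_prob are meaningful only for
   0 <= p <= 1. *)
Definition gnp_mass (R : realType) (n : nat) (p : R) (E : {set {set 'I_n}}) : R :=
  \prod_(e in vpairs n) (if e \in E then p else 1 - p).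

Definition gnp_prob (R : realType) (n : nat) (p : R)
    (A : pred {set {set 'I_n}}) : R :=
  \sum_(E : {set {set 'I_n}} | (E \subset vpairs n) && A E) gnp_mass p E.

(* A copy is a not necessarily induced subgraph isomorphic to (V, H), i.e. the
   image of an injective edge-preserving map. *)
Definition contains_copy (V : finType) (H : rel V) (n : nat)
    (E : {set {set 'I_n}}) : bool :=
  [exists f : {ffun V -> 'I_n}, injectiveb f &&
     [forall u, forall v, H u v ==> ([set f u; f v] \in E)]].

(* The tree T(n, D), for 3 <= D <= n: n = (D - 1) k - r with 0 <= r <= D - 2. *)
Definition tree_k (n D : nat) : nat := ((n + (D - 2)) %/ (D - 1))%N.

Definition tree_r (n D : nat) : nat := ((D - 1) * tree_k n D - n)%N.

(* Number of leaves attached to the path vertex of (0-based) index i < k. *)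
Definition tree_leaves (n D i : nat) : nat :=
  if i.+1 == tree_k n D then (D - 2 - tree_r n D)%N else (D - 2)%N.

(* inl i is the path vertex of index i; inr (Tagged _ j) with tag i is the j-th
   leaf attached to it. *)
Definition tree_vertex (n D : nat) : finType :=
  ('I_(tree_k n D) + {i : 'I_(tree_k n D) & 'I_(tree_leaves n D i)})%type.

Definition tree_adj (n D : nat) : rel (tree_vertex n D) := fun u v =>
  match u, v with
  | inl i, inl j => (i.+1 == j :> nat) || (j.+1 == i :> nat)
  | inl i, inr l => tag l == i
  | inr l, inl i => tag l == i
  | inr _, inr _ => false
  end.

Arguments contains_copy {V} H {n} E.
Arguments gnp_prob {R} n p A.
Arguments tree_adj n D : clear implicits.

Lemma tree_kr (n D : nat) : (2 <= D)%N ->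
  (n + tree_r n D = (D - 1) * tree_k n D /\ tree_r n D <= D - 2)%N.
Proof.
move=> D2; rewrite /tree_r /tree_k.
have := divn_eq (n + (D - 2)) (D - 1).
have : ((n + (D - 2)) %% (D - 1) < D - 1)%N by rewrite ltn_mod; lia.
set m := (_ %% _)%N; set q := (_ %/ _)%N; rewrite mulnC.
by set x := ((D - 1) * q)%N => *; lia.
Qed.

Lemma card_tree_vertex (n D : nat) : (2 <= D)%N -> (0 < n)%N ->
  #|tree_vertex n D| = n.
Proof.
move=> D2 n0; have [nr rD] := tree_kr n D2.
rewrite card_sum card_tagged card_ord sumnE big_map big_enum /=.
under eq_bigr do rewrite card_ord.
rewrite /tree_leaves.
case: (tree_k n D) nr => [|k] nr; first by lia.
rewrite big_ord_recr /= eqxx.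
under eq_bigr => i _.
  have -> : (i.+1 == k.+1) = false by apply/negbTE; have := ltn_ord i; lia.
  over.
rewrite sum_nat_const card_ord.
by move: nr rD; rewrite mulnS mulnBl mulnBr; nia.
Qed.

Lemma gnp_prob_total (R : realType) (n : nat) (p : R) :
  gnp_prob n p (fun _ : {set {set 'I_n}} => true) = 1.
Proof.
pose F (e : {set 'I_n}) : R := if e \in vpairs n then p else 0.
pose G (e : {set 'I_n}) : R := if e \in vpairs n then 1 - p else 1.
have <- : \prod_(e : {set 'I_n}) (F e + G e) = 1.
  rewrite big1 // => e _; rewrite /F /G.
  by case: ifP => _; rewrite ?add0r // addrC subrK.
rewrite bigA_distr /gnp_prob [RHS](bigID (fun E : {set {set 'I_n}} => E \subset vpairs n)) /=.
rewrite [X in _ + X]big1 ?addr0; last first.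
  move=> E /fintype.subsetPn[e eE eN].
  by rewrite (bigD1 e) //= eE /F (negbTE eN) mul0r.
apply: eq_big => [E|E]; first by rewrite andbT.
rewrite andbT => sE; rewrite /gnp_mass big_mkcond /=; apply: eq_bigr => e _.
rewrite /F /G; case: ifP => [//|eN].
by case: ifP => // eE; have := fintype.subsetP sE e eE; rewrite eN.
Qed.

(* Main.v *)
(* The path vertices of T(n, D) form a dominating set of size k <= 4n / D.  A
   fixed set of size k dominates G(n,p) with probability
   (1 - (1-p)^k)^(n-k) <= exp (- (n-k) (1-p)^k), where (1-p)^k >= n^(-eps/2) for
   delta <= eps/16; this beats the n^k <= exp (4 n^(1-eps) ln n) choices of the
   set, so a union bound concludes. *)
Require Import Defs.
From mathcomp Require Import all_boot all_order all_algebra.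
From mathcomp Require Import all_classical all_reals all_analysis.
From mathcomp Require Import zify ring lra.

Import Order.TTheory GRing.Theory Num.Theory.
Local Open Scope ring_scope.

(** * Edge avoidance and domination in G(n,p) *)

Section GnpProbability.
Context {R : realType} (n : nat) (p : R).
Implicit Types (E F : {set {set 'I_n}}) (S W : {set 'I_n}).

Lemma gnp_mass_ge0 E : 0 <= p <= 1 -> 0 <= gnp_mass p E.
Proof.
move=> /andP[p0 p1]; apply: prodr_ge0 => e _; case: ifP => // _.
by rewrite subr_ge0.
Qed.

Lemma gnp_prob_indicator (A : pred {set {set 'I_n}}) :
  gnp_prob n p A =
    \sum_(E : {set {set 'I_n}} | E \subset vpairs n) gnp_mass p E * (A E)%:R.
Proof.
rewrite /gnp_prob big_mkcondr /=; apply: eq_bigr => E _.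
by case: (A E); rewrite ?mulr1 ?mulr0.
Qed.

Lemma gnp_prob_union_bound (I : finType) (P : pred I)
    (A : pred {set {set 'I_n}}) (B : I -> pred {set {set 'I_n}}) :
  0 <= p <= 1 ->
  (forall E, A E -> exists2 i, P i & B i E) ->
  gnp_prob n p A <= \sum_(i | P i) gnp_prob n p (B i).
Proof.
move=> p01 AB; under eq_bigr do rewrite gnp_prob_indicator.
rewrite gnp_prob_indicator exchange_big /=; apply: ler_sum => E _.
rewrite -mulr_sumr ler_wpM2l ?gnp_mass_ge0//.
have [/AB[i Pi BiE]|_] := boolP (A E); last exact: sumr_ge0.
by rewrite (bigD1 i)//= BiE lerDl sumr_ge0.
Qed.

(** Each pair contributes a factor [a e + b e], present or absent. Setting [a] to 0 on [F] and
    outside [vpairs n] kills exactly the unwanted edge sets; the factor is then [1 - p] on [F] and 1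
    elsewhere. *)
Lemma gnp_prob_disjoint F : F \subset vpairs n ->
  gnp_prob n p (fun E => [disjoint E & F]) = (1 - p) ^+ #|F|.
Proof.
move=> Fv.
pose a (e : {set 'I_n}) : R := if (e \in vpairs n) && (e \notin F) then p else 0.
pose b (e : {set 'I_n}) : R := if e \in vpairs n then 1 - p else 1.
transitivity (\prod_(e : {set 'I_n}) (a e + b e)); last first.
  rewrite -prodr_const [RHS]big_mkcond /=; apply: eq_bigr => e _; rewrite /a /b.
  have [eF|eF] := boolP (e \in F).
    by rewrite (fintype.subsetP Fv _ eF) add0r.
  by case: (e \in vpairs n); rewrite /= ?add0r // addrC subrK.
rewrite bigA_distr /gnp_prob.
rewrite [RHS](bigID (fun E => (E \subset vpairs n) && [disjoint E & F])) /=.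
rewrite [X in _ = _ + X]big1 ?addr0; last first.
  move=> E; rewrite negb_and.
  suff H : (exists2 e, e \in E & ~~ ((e \in vpairs n) && (e \notin F))) ->
      \prod_e (if e \in E then a e else b e) = 0.
    case/orP => [/fintype.subsetPn[e eE eN]|].
      by apply: H; exists e => //; rewrite (negbTE eN).
    rewrite -setI_eq0 => /set0Pn[e]; rewrite inE => /andP[eE eF].
    by apply: H; exists e => //; rewrite eF andbF.
  by case=> e eE eN; rewrite (bigD1 e) //= eE /a (negbTE eN) mul0r.
apply: eq_bigr => E /andP[Ev dEF]; rewrite /gnp_mass big_mkcond /=.
apply: eq_bigr => e _; rewrite /a /b.
have [eE|eE] := boolP (e \in E); last by [].
by rewrite (fintype.subsetP Ev _ eE) (disjointFr dEF eE).
Qed.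

Definition cross_pairs S W : {set {set 'I_n}} :=
  [set [set uv.1; uv.2] | uv in finset.setX S W].

Lemma cross_pairs_sub S W : [disjoint S & W] -> cross_pairs S W \subset vpairs n.
Proof.
move=> dSW; apply/fintype.subsetP => e /imsetP[[u v]] /=.
rewrite !inE /= => /andP[uS vW] ->; rewrite cards2.
by have -> : u != v by apply: contraTneq vW => <-; rewrite (disjointFr dSW uS).
Qed.

Lemma card_cross_pairs S W : [disjoint S & W] ->
  #|cross_pairs S W| = (#|S| * #|W|)%N.
Proof.
move=> dSW; rewrite card_in_imset ?cardsX //.
move=> [u v] [u' v']; rewrite !inE /= => /andP[uS vW] /andP[uS' vW'] euv.
have neq x y : x \in S -> y \in W -> (x == y) = false.
  by move=> xS yW; apply/negbTE; apply: contraTneq yW => <-; rewrite (disjointFr dSW xS).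
have : u \in [set u'; v'] by rewrite -euv !inE eqxx.
rewrite !inE (neq u v') // orbF => /eqP ->.
have : v \in [set u'; v'] by rewrite -euv !inE eqxx orbT.
by rewrite !inE eq_sym (neq u' v) //= => /eqP ->.
Qed.

Definition dominates S E : bool :=
  [forall (v | v \notin S), [exists u in S, [set u; v] \in E]].

(* Inclusion-exclusion over the sets W of vertices outside S without a
   neighbour in S. *)
Lemma gnp_prob_dominates S :
  gnp_prob n p (dominates S) = (1 - (1 - p) ^+ #|S|) ^+ (n - #|S|).
Proof.
(* Indicator that [v] has no neighbour in [S]; domination is the product of the complementary
   indicators. *)
pose c (v : 'I_n) E : R := [forall u in S, [set u; v] \notin E]%:R.
have domE E : (dominates S E)%:R = \prod_(v in ~: S) (1 - c v E).
  have [/forallP dS|] := boolP (dominates S E).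
    rewrite big1 // => v; rewrite inE => vS.
    have /existsP[u /andP[uS uvE]] := implyP (dS v) vS.
    suff -> : c v E = 0 by rewrite subr0.
    rewrite /c; case: forallP => // /(_ u); by rewrite uS uvE.
  rewrite negb_forall => /existsP[v]; rewrite negb_imply => /andP[vS].
  rewrite negb_exists => /forallP nE.
  rewrite (bigD1 v) ?inE //= /c.
  have -> : [forall u in S, [set u; v] \notin E].
    by apply/forallP => u; apply/implyP => uS; have := nE u; rewrite uS.
  by rewrite subrr mul0r.
have expand (f : 'I_n -> R) : \prod_(v in ~: S) (1 - f v) =
    \sum_(W : {set 'I_n} | W \subset ~: S) \prod_(v in W) (- f v).
  rewrite [LHS]big_mkcond /=.
  transitivity (\prod_v ((if v \in ~: S then - f v else 0) + 1)).
    by apply: eq_bigr => v _; case: ifP => _; rewrite ?add0r // addrC.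
  rewrite bigA_distr (bigID (fun W => W \subset ~: S)) /= [X in _ + X]big1 ?addr0.
    apply: eq_bigr => W Ws; rewrite [RHS]big_mkcond /=; apply: eq_bigr => v _.
    by case: ifP => // /(fintype.subsetP Ws) ->.
  move=> W /fintype.subsetPn[v vW vN].
  by rewrite (bigD1 v) //= vW (negbTE vN) mul0r.
(* All vertices of [W] lack a neighbour in [S] exactly when [E] avoids every pair between [S] and
   [W]. *)
have cE (W : {set 'I_n}) E : W \subset ~: S -> \prod_(v in W) (- c v E) =
    (-1) ^+ #|W| * ([disjoint E & cross_pairs S W])%:R.
  move=> Ws; rewrite prodrN; congr (_ * _).
  have [dE|] := boolP [disjoint E & cross_pairs S W].
    rewrite big1 // => v vW; rewrite /c.
    have -> // : [forall u in S, [set u; v] \notin E].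
    apply/forallP => u; apply/implyP => uS; apply/negP => uvE.
    have /negP := disjointFr dE uvE; apply; apply/imsetP.
    by exists (u, v); rewrite // finset.in_setX uS.
  rewrite -setI_eq0 => /set0Pn[e]; rewrite inE => /andP[eE /imsetP[[u v]]].
  rewrite !inE /= => /andP[uS vW] ee.
  rewrite (bigD1 v) //= /c.
  case: forallP => [/(_ u)|_]; last by rewrite mul0r.
  by rewrite uS -ee eE.
rewrite gnp_prob_indicator.
under eq_bigr => E _ do rewrite domE expand mulr_sumr.
rewrite exchange_big /=.
(* Expanding this constant product by the same identity lets both sides be compared for each [W]:
   the common term is [(-1)^|W| (1-p)^(|S||W|)]. *)
transitivity (\prod_(v in ~: S) (1 - (1 - p) ^+ #|S|)); last first.
  by rewrite prodr_const (cardsCs (~: S)) finset.setCK card_ord.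
rewrite expand; apply: eq_bigr => W Ws.
have dSW : [disjoint S & W] by rewrite disjoint_sym finset.disjoints_subset.
under eq_bigr => E _ do rewrite cE // mulrCA.
rewrite -mulr_sumr -gnp_prob_indicator gnp_prob_disjoint ?cross_pairs_sub //.
by rewrite card_cross_pairs // exprM prodr_const [RHS]exprNn.
Qed.

End GnpProbability.

Arguments dominates {n} S E.

(** * From tree copies to dominating sets *)

Lemma bin_leq_exp (n k : nat) : ('C(n, k) <= n ^ k)%N.
Proof.
apply: (@leq_trans (n ^_ k)%N); first by rewrite -bin_ffact leq_pmulr ?fact_gt0.
rewrite ffact_prod -[k in (_ ^ k)%N]card_ord -prod_nat_const.
by apply: leq_prod => i _; exact: leq_subr.
Qed.

(** The tree has [n] vertices, so an embedding is onto: a vertex outside the image of the path is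
    the image of a leaf, hence adjacent to the image of that leaf's path vertex. *)
Lemma tree_copy_dominates (n D : nat) (E : {set {set 'I_n}}) :
  (2 <= D)%N -> (0 < n)%N -> contains_copy (tree_adj n D) E ->
  exists2 S : {set 'I_n}, #|S| == tree_k n D & dominates S E.
Proof.
move=> D2 n0 /existsP[f /andP[/injectiveP f_inj /forallP fE]].
pose g (i : 'I_(tree_k n D)) := f (inl i); exists [set g i | i : 'I_(tree_k n D)].
  by rewrite card_imset ?card_ord // => i j /f_inj [].
apply/forallP => v; apply/implyP => vS.
have /codomP[[i|l] vf] : v \in codom f.
  by rewrite (inj_card_onto f_inj) // card_ord card_tree_vertex.
  by move: vS; rewrite vf -/(g i) imset_f.
apply/existsP; exists (g (tag l)); rewrite imset_f //=.
by have /forallP/(_ (inr l))/implyP := fE (inl (tag l)); rewrite vf; apply => /=.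
Qed.

Lemma tree_k_gt0 (n D : nat) : (2 <= D)%N -> (0 < n)%N -> (0 < tree_k n D)%N.
Proof. by move=> D2 n0; have [nr _] := tree_kr n D2; case: (tree_k n D) nr; lia. Qed.

(** Here [(D-1)k = n + r <= 2n] because [r <= D - 2 <= n], and [D <= 2(D-1)]. *)
Lemma tree_k_bound (n D : nat) : (2 <= D <= n)%N -> (tree_k n D * D <= 4 * n)%N.
Proof. by move=> /andP[D2 Dn]; have [] := tree_kr n D2; nia. Qed.

Lemma gnp_prob_tree_copy (R : realType) (n D : nat) (p : R) (k := tree_k n D) :
  (2 <= D)%N -> (0 < n)%N -> 0 <= p <= 1 ->
  gnp_prob n p (contains_copy (tree_adj n D)) <=
    n%:R ^+ k * (1 - (1 - p) ^+ k) ^+ (n - k).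
Proof.
move=> D2 n0 p01.
apply: (le_trans (gnp_prob_union_bound _ _ _ (fun S : {set 'I_n} => #|S| == k)
  _ _ p01 (fun E => @tree_copy_dominates n D E D2 n0))).
under eq_bigr => S /eqP Sk do rewrite gnp_prob_dominates Sk.
have -> : \sum_(S : {set 'I_n} | #|S| == k) (1 - (1 - p) ^+ k) ^+ (n - k)
    = 'C(n, k)%:R * (1 - (1 - p) ^+ k) ^+ (n - k) :> R.
  rewrite sumr_const -[n in 'C(n, _)]card_ord -card_draws mulr_natl.
  by congr (_ *+ _); apply: eq_card => S; rewrite !inE.
apply: ler_wpM2r; last by rewrite -natrX ler_nat bin_leq_exp.
move: p01 => /andP[p0 p1]; apply: exprn_ge0; rewrite subr_ge0.
by apply: exprn_ile1; lra.
Qed.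

(** * Estimates for large n *)

(** Since [(1+2p)(1-p) = 1 + p(1-2p) >= 1], one has [1/(1-p) <= 1 + 2p <= expR (2p)]. *)
Lemma expRN2_le (R : realType) (p : R) : 0 <= p <= 1 / 2 -> expR (- (2 * p)) <= 1 - p.
Proof.
move=> /andP[p0 p2]; rewrite expRN invf_ple ?posrE ?expR_gt0 //; last lra.
apply: (le_trans _ (expR_ge1Dx (2 * p))).
by rewrite -div1r ler_pdivrMr; nra.
Qed.

Theorem theorem2 (R : realType) (eps : R) (heps : 0 < eps) :
  exists delta : R, 0 < delta /\
  forall eta : R, 0 < eta ->
  exists n0 : nat, forall n D : nat, (n0 <= n)%N ->
  n%:R `^ eps <= D%:R -> D%:R <= n%:R / ln n%:R :> R ->
  let p := delta * D%:R * ln n%:R / n%:R in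
  (0 <= p <= 1) /\ gnp_prob n p (contains_copy (tree_adj n D)) <= eta.
Proof.
(* The bound [16 delta <= 1] yields [p <= 1/16]; the bound [16 delta <= eps] yields
   [2pk <= eps L / 2]. *)
pose delta := Num.min eps 1 / 16.
have [d0 d16 deps] : [/\ 0 < delta, 16 * delta <= 1 & 16 * delta <= eps].
  have -> : 16 * delta = Num.min eps 1 by rewrite /delta; field.
  by rewrite divr_gt0 ?lt_min ?heps ?ltr01 // !ge_min !lexx orbT.
clearbody delta; exists delta; split=> // eta eta0.
(* One positive summand for each of [eps^2 L >= 128], [eps L >= 2] and [L >= 1], where
   [L = ln n]. *)
pose L0 := 128 / eps ^+ 2 + 2 / eps + 1.
have /ltW nL0 := archi_boundP (expR_ge0 L0).
(* The first summand forces [ln n >= L0], the second [1/n <= eta]; the probability is bounded by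
   [1/n]. *)
exists (Num.bound (expR L0) + Num.bound eta^-1)%N => n D n_large nD Dn p.
pose N : R := n%:R; pose L := ln N; pose k := tree_k n D.
(* Thus [e] is [n^(eps/2)], and [e^2 = n^eps <= D]. *)
pose z := eps * L; pose e := expR (z / 2).
have LN : expR L0 <= N by apply: (le_trans nL0); rewrite ler_nat; lia.
have N0 : 0 < N by apply: lt_le_trans LN; exact: expR_gt0.
have etaN : N^-1 <= eta.
  rewrite invf_ple ?posrE //.
  have eta_inv_ge0 : 0 <= eta^-1 by rewrite invr_ge0 ltW.
  by apply: (le_trans (ltW (archi_boundP eta_inv_ge0))); rewrite ler_nat; lia.
have L0L : L0 <= L by rewrite -[L0]expRK ler_ln ?posrE ?expR_gt0.
have expL : expR L = N by rewrite lnK ?posrE.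
have [L1 z2 epsL] : [/\ 1 <= L, 2 <= z & 128 <= eps ^+ 2 * L].
  have a0 : 0 < 128 / eps ^+ 2 by rewrite divr_gt0 // exprn_gt0.
  have b0 : 0 < 2 / eps by rewrite divr_gt0.
  move: L0L; rewrite /L0 => L0L; split; first lra.
    by rewrite /z mulrC -ler_pdivrMr //; lra.
  by rewrite mulrC -ler_pdivrMr ?exprn_gt0 //; lra.
(* The quadratic term of the exponential series alone is [eps^2 L^2 / 8 >= 16 L]. *)
have e16 : 16 * L <= e.
  have z20 : 0 <= z / 2 by lra.
  have := expR_ge1Dxn 1 z20; rewrite -/e.
  have -> : (z / 2) ^+ 2 / 2`!%:R = eps ^+ 2 * L * L / 8 by rewrite /z (_ : 2`! = 2)%N //; field.
  nra.
have eD : e ^+ 2 <= D%:R.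
  apply: le_trans nD; rewrite /powR gt_eqF // -/N -/L -/z /e -expRM_natl.
  by rewrite mulrC divfK.
have D3 : 3 <= D%:R :> R by apply: le_trans eD; nra.
have D2 : (2 <= D)%N by rewrite -(ler_nat R); lra.
have DL : D%:R * L <= N by rewrite -ler_pdivlMr //; lra.
have DN : (D <= n)%N by rewrite -(ler_nat R) -/N; nra.
have n0 : (0 < n)%N by rewrite -(ltr_nat R).
have kD : k%:R * D%:R <= 4 * N :> R.
  by rewrite -!natrM ler_nat tree_k_bound ?D2.
have k1 : 1 <= k%:R :> R by rewrite ler1n tree_k_gt0.
have pN : p * N = delta * (D%:R * L) by rewrite /p divfK ?gt_eqF // mulrA.
have [p0 p16] : 0 <= p /\ p <= 1 / 16.
  split; first by rewrite -(pmulr_lge0 _ N0) pN !mulr_ge0 //; lra.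
  by rewrite -(ler_pM2r N0) pN; nra.
have p01 : 0 <= p <= 1 by rewrite p0; lra.
split=> //; apply: (le_trans (gnp_prob_tree_copy _ _ _ _ D2 n0 p01)).
apply: le_trans etaN; rewrite -/k -/N; set q := (1 - p) ^+ k.
have q1 : q <= 1 by apply: exprn_ile1; lra.
have kp : 2 * p * k%:R <= z / 2.
  rewrite -(ler_pM2r N0).
  have -> : 2 * p * k%:R * N = 2 * delta * L * (k%:R * D%:R) by transitivity (2 * k%:R * (p * N)); [ring | rewrite pN; ring].
  have dL : 0 <= 2 * delta * L by nra.
  apply: (le_trans (ler_wpM2l dL kD)); rewrite /z.
  have LN0 : 0 <= L * N by rewrite mulr_ge0 //; lra.
  nra.
(* This is [(1-p)^k >= expR (-2pk) >= n^(-eps/2)], with the denominator cleared. *)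
have qe : 1 <= q * e.
  have : expR (- (2 * p)) ^+ k <= q.
    by apply: lerXn2r; rewrite ?nnegrE ?expR_ge0 ?expRN2_le //; lra.
  rewrite -expRM_natl => qp.
  have {}qp : expR (- (z / 2)) <= q.
    by apply: le_trans qp; rewrite ler_expR mulrC; lra.
  by rewrite -ler_pdivrMr ?expR_gt0 // div1r -expRN.
(* After multiplying by [e], it suffices that [4kLe <= N], which follows from [16 L <= e] and
   [k e^2 <= k D <= 4N]. *)
have kLq : 4 * k%:R * L <= N * q.
  have e0 : 0 < e by exact: expR_gt0.
  rewrite -(ler_pM2r e0) -mulrA.
  apply: (@le_trans _ _ N); last by rewrite -mulrA ler_peMr // ltW.
  have ke : k%:R * e ^+ 2 <= 4 * N by apply: le_trans kD; rewrite ler_wpM2l //; lra.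
  have : k%:R * e * (16 * L) <= k%:R * e * e by rewrite ler_wpM2l // mulr_ge0 //; lra.
  nra.
(* Needed to cast the truncated subtraction [n - k] into the reals. *)
have kn : (k <= n)%N by rewrite -(ler_nat R) -/N; nra.
have -> : N ^+ k = expR (k%:R * L) by rewrite expRM_natl expL.
have : (1 - q) ^+ (n - k) <= expR (- q) ^+ (n - k).
  apply: lerXn2r; rewrite ?nnegrE ?expR_ge0 ?subr_ge0 //.
  exact: expR_ge1Dx.
rewrite -expRM_natl natrB // -/N => /(ler_wpM2l (expR_ge0 (k%:R * L))) H.
apply: (le_trans H); rewrite -expRD -expL -expRN ler_expR.
(* Since [q <= 1 <= L], [(N-k)q >= 4kL - k >= 3kL], so the exponent is at most [-2kL <= -L], using
   [k >= 1]. *)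
nra.
Qed.
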